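(* Let $(Y,X,W_1,W_2)$ with $W_1\in\mathbb R^{d_1}$, $W_2\in\mathbb R^{d_2}$ ($d_2\ge1$) have finite second moments, and suppose the joint distribution of $(Y,X,W_1)$ is known. Suppose (A1) $\operatorname{var}(Y,X,W_1,W_2)$ is positive definite and $\pi_2=0$. Then (i) $\beta_{\text{long}}=\beta_{\text{med}}$, and (ii) the identified set for $\gamma_1$ is $\mathbb R^{d_1}$: for every $g_1\in\mathbb R^{d_1}$ there exists a random vector $(\tilde Y,\tilde X,\tilde W_1,\tilde W_2)$ with $(\tilde Y,\tilde X,\tilde W_1)\overset{d}{=}(Y,X,W_1)$, satisfying (A1) and $\pi_2=0$, whose long-regression coefficient on $\tilde W_1$ equals $g_1$.
   Context: $\beta_{\text{long}},\gamma_1,\gamma_2$ are the coefficients on $X,W_1,W_2$ in the linear projection of $Y$ on $(1,X,W_1,W_2)$; $\pi_1,\pi_2$ are the coefficients on $W_1,W_2$ in the linear projection of $X$ on $(1,W_1,W_2)$; $\beta_{\text{med}}$ is the coefficient on $X$ in the linear projection of $Y$ on $(1,X,W_1)$. *)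

(* Defs.v *)
From HB Require Import structures.
From mathcomp Require Import all_boot all_order all_algebra.
From mathcomp Require Import all_classical all_reals all_analysis.
Unset Printing Implicit Defensive.
Import Order.TTheory GRing.Theory Num.Theory.
Local Open Scope classical_set_scope.
Local Open Scope ring_scope.

Definition vcat {A : Type} {m n : nat} (F : 'I_m -> A) (G : 'I_n -> A)
  : 'I_(m + n) -> A :=
  fun i => match fintype.split i with inl j => F j | inr j => G j end.

Definition vone {A : Type} (a : A) : 'I_1 -> A := fun _ => a.

Section Defs.
Context {d : measure_display} {T : measurableType d} {R : realType}.
Variable P : probability T R.

Definition finite_2nd_moments {k : nat} (Z : 'I_k -> T -> R) : Prop :=
  forall i, measurable_fun setT (Z i) /\
            P.-integrable setT (fun w => ((Z i w) ^+ 2)%:E).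

Definition varmx {k : nat} (Z : 'I_k -> T -> R) : 'M[R]_k :=
  \matrix_(i, j) fine (covariance P (Z i) (Z j)).

Definition lp_mse {k : nat} (Y : T -> R) (V : 'I_k -> T -> R)
  (a : R) (b : 'I_k -> R) : \bar R :=
  \int[P]_w (((Y w - a - \sum_(i < k) b i * V i w) ^+ 2)%:E).

Definition is_linproj {k : nat} (Y : T -> R) (V : 'I_k -> T -> R)
  (a : R) (b : 'I_k -> R) : Prop :=
  forall (a' : R) (b' : 'I_k -> R), (lp_mse Y V a b <= lp_mse Y V a' b')%E.

End Defs.

Definition posdef {R : realType} {k : nat} (M : 'M[R]_k) : Prop :=
  forall u : 'rV[R]_k, u != 0 -> 0 < (u *m M *m u^T) ord0 ord0.

Definition rectangles {R : realType} (k : nat) : set (set ('I_k -> R)) :=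
  [set B | exists A : 'I_k -> set R,
     (forall i, measurable (A i)) /\ B = [set x | forall i, A i (x i)]].

Definition borelRk {R : realType} (k : nat) : set (set ('I_k -> R)) :=
  <<s rectangles k >>.

Definition law_eq {R : realType} {k : nat}
  {d : measure_display} {T : measurableType d} (P : probability T R)
  (Z : 'I_k -> T -> R)
  {d' : measure_display} {T' : measurableType d'} (P' : probability T' R)
  (Z' : 'I_k -> T' -> R) : Prop :=
  forall B, borelRk k B ->
    P [set w | B (fun i => Z i w)] = P' [set w | B (fun i => Z' i w)].

Definition full4 {A : Type} {d1 d2 : nat} (y x : A) (w1 : 'I_d1 -> A)
  (w2 : 'I_d2 -> A) : 'I_(1 + 1 + d1 + d2) -> A :=
  vcat (vcat (vcat (vone y) (vone x)) w1) w2.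

Definition first3 {A : Type} {d1 : nat} (y x : A) (w1 : 'I_d1 -> A)
  : 'I_(1 + 1 + d1) -> A :=
  vcat (vcat (vone y) (vone x)) w1.

Definition A1_pi2 {R : realType} {d : measure_display} {T : measurableType d}
  (P : probability T R) {d1 d2 : nat} (Y X : T -> R)
  (W1 : 'I_d1 -> T -> R) (W2 : 'I_d2 -> T -> R) : Prop :=
  posdef (varmx P (full4 Y X W1 W2)) /\
  exists (pi0 : R) (pi1 : 'I_d1 -> R),
    is_linproj P X (vcat W1 W2) pi0 (vcat pi1 (fun _ : 'I_d2 => 0)).

(* Main.v *)
Require Import Defs.
From HB Require Import structures.
From mathcomp Require Import all_boot all_order all_algebra.
From mathcomp Require Import all_classical all_reals all_analysis.
From mathcomp Require Import ring lra.
Import Order.TTheory GRing.Theory Num.Theory.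
Local Open Scope classical_set_scope.
Local Open Scope ring_scope.

(** All variables are affine combinations of [(Y, X, W1, W2)], so covariances
    become values of the quadratic form of the positive definite matrix
    [S = var(Y, X, W1, W2)] on coefficient vectors, and linear projections become
    normal equations for [S].

    Since [pi2 = 0], the residual of [X] on [W1] is also its residual on
    [(W1, W2)], so the long and medium regressions identify the same coefficient
    on [X].

    For the identified set no new probability space is needed: [Y], [X], [W1] are
    kept and a single component of [W2] is replaced by a suitable linear
    combination of the original variables. *)

(** * Bilinear forms, orthogonal projection and first-order conditions *)

Definition bil {R : realType} {n : nat} (S : 'M[R]_n) (u v : 'rV[R]_n) : R :=
  (u *m S *m v^T) ord0 ord0.

Local Notation evec i := (delta_mx ord0 i).

Section BilinearForm.
Context {R : realType} {n : nat}.
Implicit Types (S M : 'M[R]_n) (u v w x : 'rV[R]_n).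

Lemma bilDl S u v w : bil S (u + v) w = bil S u w + bil S v w.
Proof. by rewrite /bil !mulmxDl mxE. Qed.

Lemma bilZl S a u v : bil S (a *: u) v = a * bil S u v.
Proof. by rewrite /bil -!scalemxAl mxE. Qed.

Lemma bilDr S u v w : bil S u (v + w) = bil S u v + bil S u w.
Proof. by rewrite /bil raddfD mulmxDr mxE. Qed.

Lemma bilZr S a u v : bil S u (a *: v) = a * bil S u v.
Proof. by rewrite /bil linearZ -scalemxAr mxE. Qed.

Lemma bilNl S u v : bil S (- u) v = - bil S u v.
Proof. by rewrite -scaleN1r bilZl mulN1r. Qed.

Lemma bilNr S u v : bil S u (- v) = - bil S u v.
Proof. by rewrite -scaleN1r bilZr mulN1r. Qed.

Lemma bilC S u v : S^T = S -> bil S u v = bil S v u.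
Proof.
move=> symS; rewrite /bil.
have -> : v *m S *m u^T = (u *m S *m v^T)^T.
  by rewrite !trmx_mul trmxK symS mulmxA.
by rewrite [RHS]mxE.
Qed.

Lemma bil_evecr S u i : bil S u (evec i) = (u *m S) ord0 i.
Proof. by rewrite /bil trmx_delta -colE [LHS]mxE. Qed.

Lemma bil_sumE S u v : bil S u v = \sum_i bil S u (evec i) * v ord0 i.
Proof.
rewrite [LHS]mxE; apply: eq_bigr => i _.
by rewrite bil_evecr [v^T _ _]mxE.
Qed.

Lemma bil_eq0 S u v :
  (forall i, v ord0 i = 0 \/ bil S u (evec i) = 0) -> bil S u v = 0.
Proof.
move=> uv; rewrite bil_sumE big1// => i _.
by case: (uv i) => ->; rewrite ?mulr0 ?mul0r.
Qed.

(** A linear change of the random vector by [M] becomes right multiplication of coefficient vectors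
    by [M]. *)
Lemma bil_congr S M u v : bil (M *m S *m M^T) u v = bil S (u *m M) (v *m M).
Proof. by rewrite /bil trmx_mul !mulmxA. Qed.

(* Orthogonal projection of [y] on the coordinate vectors indexed by [D]. The
   Gram matrix of that family need not be invertible; solvability follows from
   definiteness, which forces its kernel to annihilate the family itself. *)
Lemma coord_projection S (D : pred 'I_n) y : posdef S -> S^T = S ->
  exists u, (forall i, ~~ D i -> u ord0 i = 0) /\
            (forall i, D i -> bil S (y - u) (evec i) = 0).
Proof.
move=> pS symS.
(* [V] is the diagonal projector on the coordinates in [D], so [G] below is the Gram matrix padded
   with zeros to full size. *)
pose V : 'M[R]_n := \matrix_(i, j) ((i == j) && D i)%:R.
have VT : V^T = V.
  by apply/matrixP => i j; rewrite !mxE eq_sym; case: eqP => [->|].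
have mulV (u : 'rV[R]_n) i : (u *m V) ord0 i = u ord0 i * (D i)%:R.
  rewrite mxE (bigD1 i)//= !mxE eqxx /= big1 ?addr0// => j ji.
  by rewrite mxE (negbTE ji) mulr0.
pose G := V *m S *m V^T.
have VC0 : V^T *m cokermx G = 0.
  apply: trmx_inj; rewrite trmx_mul trmxK trmx0.
  apply/row_matrixP => i; rewrite row0 row_mul.
  set c := row i _; apply/eqP; apply: contraT => /pS.
  have -> : c *m V *m S *m (c *m V)^T = c *m (G *m c^T).
    by rewrite /G trmx_mul !mulmxA.
  by rewrite /c tr_row trmxK colE (mulmxA G) mulmx_coker mul0mx mulmx0 mxE ltxx.
(* The normal equations [b *m G = y *m S *m V^T] are solvable because the right side kills the
   cokernel of [G]. *)
have /submxP[b yb] : (y *m S *m V^T <= G)%MS.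
  rewrite submxE; apply/eqP; rewrite -[LHS]mulmxA.
  exact: etrans (congr1 (mulmx (y *m S)) VC0) (mulmx0 _ _).
exists (b *m V); split=> [i Di|i Di]; first by rewrite mulV (negbTE Di) mulr0.
have /rowP/(_ i) : (y - b *m V) *m S *m V = 0.
  by rewrite 2!mulmxBl -{1}VT yb /G VT !mulmxA subrr.
by rewrite mulV Di mulr1 bil_evecr => ->; rewrite mxE.
Qed.

(** First-order condition at [t = 0]: for nonzero [b] the linear term wins at a small step in the
    direction of [b], making the value negative. *)
Lemma quadratic_min_linear0 (b c : R) :
  (forall t, 0 <= t ^+ 2 * c - 2 * t * b) -> b = 0.
Proof.
move=> H; apply/eqP; apply: contraT => b0.
(* This step size keeps [e * c] at most 1 whatever the sign of [c], so the factor [e * c - 2] is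
   negative. *)
pose e := (1 + `|c|)^-1.
have c1 : 0 < 1 + `|c| by rewrite ltr_pwDl.
have e0 : 0 < e by rewrite invr_gt0.
have ec : e * c <= 1.
  by rewrite mulrC ler_pdivrMr// mul1r (le_trans (ler_norm c))// lerDr.
have b2 : 0 < b ^+ 2 by rewrite exprn_even_gt0.
have := H (b * e).
have -> : (b * e) ^+ 2 * c - 2 * (b * e) * b = b ^+ 2 * e * (e * c - 2) by ring.
rewrite pmulr_rge0; last by rewrite mulr_gt0.
by rewrite subr_ge0 => /le_trans/(_ ec); lra.
Qed.

Lemma bil_sqrD S u v : S^T = S ->
  bil S (u + v) (u + v) = bil S u u + 2 * bil S u v + bil S v v.
Proof. by move=> symS; rewrite !bilDl !bilDr (bilC S v u)//; ring. Qed.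

Lemma bil_min_orth S u v : S^T = S ->
  (forall t, bil S u u <= bil S (u - t *: v) (u - t *: v)) -> bil S u v = 0.
Proof.
move=> symS H; apply: (@quadratic_min_linear0 _ (bil S v v)) => t.
have := H t.
rewrite bil_sqrD// !bilNr bilNl !bilZr bilZl; lra.
Qed.

End BilinearForm.

(** * Linear combinations of a family of random variables *)

Definition lincomb {T : Type} {R : realType} {n : nat} (Z : 'I_n -> T -> R)
  (u : 'rV[R]_n) : T -> R := fun w => \sum_i u ord0 i * Z i w.

Lemma lincomb_evec {T : Type} {R : realType} {n : nat} (Z : 'I_n -> T -> R) i :
  lincomb Z (evec i) = Z i.
Proof.
apply/funext => w; rewrite /lincomb (bigD1 i)//= mxE !eqxx mul1r.
by rewrite big1 ?addr0// => j ji; rewrite mxE (negbTE ji) mul0r.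
Qed.

Lemma lincombB {T : Type} {R : realType} {n : nat} (Z : 'I_n -> T -> R) u v w :
  lincomb Z (u - v) w = lincomb Z u w - lincomb Z v w.
Proof.
rewrite /lincomb -sumrB; apply: eq_bigr => i _.
by rewrite !mxE mulrBl.
Qed.

Lemma lincomb_sum {T : Type} {R : realType} {n k : nat} (Z : 'I_n -> T -> R)
    (b : 'I_k -> R) (f : 'I_k -> 'I_n) w :
  lincomb Z (\sum_j b j *: evec (f j)) w = \sum_j b j * Z (f j) w.
Proof.
rewrite /lincomb; under eq_bigr do rewrite summxE mulr_suml.
rewrite exchange_big/=; apply: eq_bigr => j _.
rewrite -[in RHS](lincomb_evec Z (f j)) /lincomb mulr_sumr.
by apply: eq_bigr => i _; rewrite !mxE mulrA.
Qed.

(** * Moments of square-integrable linear combinations *)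

Section SquareIntegrable.
Context {d : measure_display} {T : measurableType d} {R : realType}.
Variable P : probability T R.
Implicit Types X Y : T -> R.

Lemma Lfun2P X : X \in Lfun P 2%:E <->
  measurable_fun setT X /\ P.-integrable setT (fun w => ((X w) ^+ 2)%:E).
Proof.
split=> [X2|[mX /integrableP[_ iX]]].
  split; last exact: Lfun2_integrable_sqr.
  by move: X2; rewrite inE => /andP[]; rewrite inE.
rewrite inE; apply/andP; split; rewrite inE//=.
rewrite /finite_norm unlock /Lnorm poweR_lty//.
under eq_integral => x _ do rewrite /= powR_mulrn// -normrX.
exact: iX.
Qed.

Lemma Lfun21 X : X \in Lfun P 2%:E -> X \in Lfun P 1.
Proof. by move=> X2; apply: Lfun_subset12 => //; exact: fin_num_measure. Qed.

Section Family.
Context {n : nat} (Z : 'I_n -> T -> R).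
Hypothesis Z2 : forall i, Z i \in Lfun P 2%:E.

Lemma lincombE u : lincomb Z u = \sum_i (u ord0 i \o* Z i).
Proof.
apply/funext => w; rewrite /lincomb fct_sumE.
by apply: eq_bigr => i _; rewrite /= mulrC.
Qed.

Lemma lincomb_Lfun u : lincomb Z u \in Lfun P 2%:E.
Proof.
rewrite lincombE rpred_sum ?lee1n// => p1 i _.
by apply: Lfun_scale; rewrite ?ler1n.
Qed.

Lemma covariance_suml (I : Type) (r : seq I) (f : I -> T -> R) X :
  (forall i, f i \in Lfun P 2%:E) -> X \in Lfun P 2%:E ->
  covariance P (\sum_(i <- r) f i) X = (\sum_(i <- r) covariance P (f i) X)%E.
Proof.
move=> f2 X2; elim: r => [|i r IH].
  by rewrite !big_nil -[0]/(cst 0) covariance_cst_l.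
rewrite !big_cons -IH -covarianceDl//.
by rewrite rpred_sum ?lee1n.
Qed.

Lemma covariance_lincomb u v :
  covariance P (lincomb Z u) (lincomb Z v) = (bil (varmx P Z) u v)%:E.
Proof.
have cov_scale (a : R) X Y : X \in Lfun P 2%:E -> Y \in Lfun P 2%:E ->
    covariance P (a \o* X) Y = (a%:E * covariance P X Y)%E.
  by move=> X2 Y2; apply: covarianceZl; [exact: Lfun21|exact: Lfun21|
       exact: Lfun2_mul_Lfun1].
have sc2 (w : 'rV[R]_n) i : w ord0 i \o* Z i \in Lfun P 2%:E.
  by apply: Lfun_scale; rewrite ?ler1n.
rewrite /bil mxE -sumEFin [X in covariance P _ X]lincombE covarianceC.
rewrite covariance_suml ?lincomb_Lfun//; apply: eq_bigr => j _.
rewrite cov_scale ?lincomb_Lfun// covarianceC lincombE covariance_suml//.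
rewrite !mxE mulrC EFinM -sumEFin; congr (_ * _)%E.
apply: eq_bigr => i _; rewrite cov_scale// !mxE EFinM fineK//.
apply: covariance_fin_num; [exact: Lfun21|exact: Lfun21|].
exact: Lfun2_mul_Lfun1.
Qed.

Lemma varmx_sym : (varmx P Z)^T = varmx P Z.
Proof. by apply/matrixP => i j; rewrite !mxE covarianceC. Qed.

Lemma bil_varmx_ge0 u : 0 <= bil (varmx P Z) u u.
Proof. by rewrite -lee_fin -covariance_lincomb; exact: variance_ge0. Qed.

(** Variance plus squared bias: subtracting the constant [a] leaves the variance unchanged and
    shifts the mean. *)
Lemma mse_lincomb u a :
  (\int[P]_w (((lincomb Z u w - a) ^+ 2)%:E) =
   (bil (varmx P Z) u u + (fine (expectation P (lincomb Z u)) - a) ^+ 2)%:E)%E.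
Proof.
set D := lincomb Z u.
have D2 : D \in Lfun P 2%:E := lincomb_Lfun u.
have Da2 : D \- cst a \in Lfun P 2%:E.
  by rewrite rpredB ?lee1n// => p1; exact: Lfun_cst.
have DaE : expectation P ((D \- cst a) ^+ 2) \is a fin_num.
  by apply: expectation_fin_num; rewrite expr2; exact: Lfun2_mul_Lfun1.
have EDa : expectation P (D \- cst a) = (fine (expectation P D) - a)%:E.
  by rewrite expectationB ?Lfun_cst ?Lfun21// expectation_cst EFinB fineK//
     expectation_fin_num// Lfun21.
have := varianceE Da2; rewrite varianceB_cst_r// /variance covariance_lincomb EDa.
rewrite -[X in (_ = X - _)%E](fineK DaE).
rewrite -EFin_expe -EFinB => H; rewrite (EFin_inj H).
by rewrite subrK fineK// unlock.
Qed.

Lemma varmx_lincomb {k : nat} (M : 'M[R]_(k, n)) :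
  varmx P (fun i => lincomb Z (row i M)) = M *m varmx P Z *m M^T.
Proof.
apply/matrixP => i j; rewrite mxE covariance_lincomb/= /bil.
by rewrite tr_row -!row_mul colE mulmxA -colE [LHS]mxE [LHS]mxE.
Qed.

(** * Linear projections as normal equations *)

Section LinProj.
Context {k : nat} (i0 : 'I_n) (f : 'I_k -> 'I_n).

(** [i0] indexes the outcome and [f] the regressors. The intercept is left out: it affects only the
    mean of the residual, a term that [lp_mseE] separates. *)
Definition resid (b : 'I_k -> R) : 'rV[R]_n :=
  evec i0 - \sum_j b j *: evec (f j).

Lemma lp_mseE a b : lp_mse P (Z i0) (fun j => Z (f j)) a b =
  (bil (varmx P Z) (resid b) (resid b) +
   (fine (expectation P (lincomb Z (resid b))) - a) ^+ 2)%:E.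
Proof.
rewrite -mse_lincomb /lp_mse; apply: eq_integral => w _.
by rewrite lincombB lincomb_evec lincomb_sum addrAC.
Qed.

(** With the best intercept for each slope vector only the residual variance remains, so optimal
    slopes minimise it along every regressor direction. *)
Lemma linproj_orth a b : is_linproj P (Z i0) (fun j => Z (f j)) a b ->
  forall j, bil (varmx P Z) (resid b) (evec (f j)) = 0.
Proof.
move=> H j; apply: bil_min_orth => [|t]; first exact: varmx_sym.
pose b' l := b l + (l == j)%:R * t.
have rb' : resid b' = resid b - t *: evec (f j).
  rewrite /resid -addrA -opprD; congr (_ - _).
  under eq_bigr do rewrite scalerDl.
  rewrite big_split/= [X in _ + X](bigD1 j)//= eqxx mul1r.
  rewrite [X in _ + (_ + X)]big1 ?addr0//.
  by move=> l lj; rewrite (negbTE lj) mul0r scale0r.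
(* The competitor's intercept is the mean of its own residual, so its error is its variance
   alone. *)
have := H (fine (expectation P (lincomb Z (resid b')))) b'.
rewrite !lp_mseE subrr expr0n addr0 lee_fin -rb'; apply: le_trans.
by rewrite lerDl sqr_ge0.
Qed.

(** Pythagoras: changing the slopes adds to the residual a combination [v] of regressors, orthogonal
    to it, so the variance cannot decrease. *)
Lemma orth_linproj b :
  (forall j, bil (varmx P Z) (resid b) (evec (f j)) = 0) ->
  exists a, is_linproj P (Z i0) (fun j => Z (f j)) a b.
Proof.
move=> H; exists (fine (expectation P (lincomb Z (resid b)))) => a' b'.
rewrite !lp_mseE subrr expr0n addr0 lee_fin.
pose v := \sum_j (b j - b' j) *: evec (f j) : 'rV[R]_n.
have -> : resid b' = resid b + v.
  rewrite /resid -addrA; congr (_ + _).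
  by rewrite addrC -sumrB -sumrN; apply: eq_bigr => j _;
     rewrite scalerBl addrAC subrr sub0r.
rewrite bil_sqrD ?varmx_sym//.
have -> : bil (varmx P Z) (resid b) v = 0.
  rewrite /v; elim/big_ind: _ => [|x y x0 y0|j _].
  - by rewrite -(scale0r 0) bilZr mul0r.
  - by rewrite bilDr x0 y0 addr0.
  - by rewrite bilZr H mulr0.
by rewrite mulr0 addr0 -addrA lerDl addr_ge0 ?sqr_ge0// bil_varmx_ge0.
Qed.

End LinProj.
End Family.
End SquareIntegrable.

(** * Block indexing of [(Y, X, W1, W2)] *)

Section Concatenation.
Context {A : Type} {m n : nat}.
Implicit Types (F : 'I_m -> A) (G : 'I_n -> A).

Lemma vcatl F G i : vcat F G (lshift n i) = F i.
Proof. by rewrite /vcat (unsplitK (inl i)). Qed.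

Lemma vcatr F G j : vcat F G (rshift m j) = G j.
Proof. by rewrite /vcat (unsplitK (inr j)). Qed.

End Concatenation.

Lemma comp_vcat {A B : Type} {m n : nat} (h : A -> B) (F : 'I_m -> A)
    (G : 'I_n -> A) :
  (fun i => h (vcat F G i)) = vcat (fun i => h (F i)) (fun j => h (G j)).
Proof.
apply/funext => i; have [j ->|j ->] := split_ordP i; first by rewrite !vcatl.
by rewrite !vcatr.
Qed.

Section Blocks.
Context {d1 d2 : nat}.

Definition iY : 'I_(1 + 1 + d1 + d2) := lshift d2 (lshift d1 (lshift 1 ord0)).
Definition iX : 'I_(1 + 1 + d1 + d2) := lshift d2 (lshift d1 (rshift 1 ord0)).
Definition iW1 (i : 'I_d1) : 'I_(1 + 1 + d1 + d2) := lshift d2 (rshift (1 + 1) i).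
Definition iW2 (j : 'I_d2) : 'I_(1 + 1 + d1 + d2) := rshift (1 + 1 + d1) j.

Lemma block_ind (Q : 'I_(1 + 1 + d1 + d2) -> Prop) : Q iY -> Q iX ->
  (forall i, Q (iW1 i)) -> (forall j, Q (iW2 j)) -> forall i, Q i.
Proof.
move=> QY QX Q1 Q2 i; have [{}i ->|j ->] := split_ordP i; last exact: Q2.
have [{}i ->|j ->] := split_ordP i; last exact: Q1.
by have [k|k] := split_ordP i; rewrite (ord1 k) => ->.
Qed.

Context {A : Type}.
Variables (y x : A) (w1 : 'I_d1 -> A) (w2 : 'I_d2 -> A).

Lemma full4Y : full4 y x w1 w2 iY = y.
Proof. by rewrite /full4 !vcatl. Qed.

Lemma full4X : full4 y x w1 w2 iX = x.
Proof. by rewrite /full4 !vcatl vcatr. Qed.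

Lemma full4W1 i : full4 y x w1 w2 (iW1 i) = w1 i.
Proof. by rewrite /full4 vcatl vcatr. Qed.

Lemma full4W2 j : full4 y x w1 w2 (iW2 j) = w2 j.
Proof. by rewrite /full4 vcatr. Qed.

Definition full4E := (full4Y, full4X, full4W1, full4W2).

(** Here and in the next two lemmas, a regressor list is presented as an index selection from the
    single family [full4], as [linproj_orth] and [orth_linproj] require. *)
Lemma full4_long : vcat (vcat (vone x) w1) w2 =
  (fun j => full4 y x w1 w2 (vcat (vcat (vone iX) iW1) iW2 j)).
Proof.
rewrite !comp_vcat; congr (vcat (vcat _ _) _); apply/funext => i;
  by rewrite /vone full4E.
Qed.

Lemma full4_med : vcat (vone x) w1 =
  (fun j => full4 y x w1 w2 (vcat (vone iX) iW1 j)).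
Proof.
by rewrite comp_vcat; congr vcat; apply/funext => i; rewrite /vone full4E.
Qed.

Lemma full4_controls : vcat w1 w2 =
  (fun j => full4 y x w1 w2 (vcat iW1 iW2 j)).
Proof. by rewrite comp_vcat; congr vcat; apply/funext => i; rewrite full4E. Qed.

End Blocks.

(** * Coefficient vectors of the regression residuals *)

Definition cvec {R : realType} {d1 d2 : nat} (a b : R) (g1 : 'I_d1 -> R)
  (g2 : 'I_d2 -> R) : 'rV[R]_(1 + 1 + d1 + d2) := \row_i full4 a b g1 g2 i.

Section CoefficientVectors.
Context {R : realType} {d1 d2 : nat}.
Variables (a b : R) (g1 : 'I_d1 -> R) (g2 : 'I_d2 -> R).

Lemma cvecY : cvec a b g1 g2 ord0 iY = a.
Proof. by rewrite mxE full4E. Qed.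

Lemma cvecX : cvec a b g1 g2 ord0 iX = b.
Proof. by rewrite mxE full4E. Qed.

Lemma cvecW1 i : cvec a b g1 g2 ord0 (iW1 i) = g1 i.
Proof. by rewrite mxE full4E. Qed.

Lemma cvecW2 j : cvec a b g1 g2 ord0 (iW2 j) = g2 j.
Proof. by rewrite mxE full4E. Qed.

Definition cvecE := (cvecY, cvecX, cvecW1, cvecW2).

Lemma cvec_sum : cvec a b g1 g2 =
  a *: evec iY + b *: evec iX + \sum_i g1 i *: evec (iW1 i)
  + \sum_j g2 j *: evec (iW2 j).
Proof.
rewrite [LHS]row_sum_delta !big_split_ord/= !big_ord1.
congr (_ *: _ + _ *: _ + _ + _); rewrite ?cvecE//; apply: eq_bigr => i _;
  by rewrite ?cvecW1 ?cvecW2.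
Qed.

End CoefficientVectors.

Lemma resid_long {R : realType} {d1 d2 : nat} (b : R) (g1 : 'I_d1 -> R)
    (g2 : 'I_d2 -> R) :
  resid iY (vcat (vcat (vone iX) iW1) iW2) (vcat (vcat (vone b) g1) g2)
  = cvec 1 (- b) (fun i => - g1 i) (fun j => - g2 j).
Proof.
rewrite /resid cvec_sum !big_split_ord/= big_ord1 !vcatl /vone.
under eq_bigr do rewrite !vcatl !vcatr.
under [X in _ - (_ + X)]eq_bigr do rewrite !vcatr.
rewrite scale1r scaleNr 2!opprD !addrA -!sumrN.
by congr (_ + _ + _); apply: eq_bigr => i _; rewrite scaleNr.
Qed.

Lemma resid_med {R : realType} {d1 d2 : nat} (b : R) (g1 : 'I_d1 -> R) :
  resid iY (vcat (vone iX) iW1) (vcat (vone b) g1)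
  = cvec 1 (- b) (fun i => - g1 i) (fun _ : 'I_d2 => 0).
Proof.
rewrite /resid cvec_sum !big_split_ord/= big_ord1 !vcatl /vone.
under eq_bigr do rewrite !vcatr.
rewrite [X in _ = _ + X]big1 ?addr0 => [|j _]; last by rewrite scale0r.
rewrite scale1r scaleNr opprD !addrA -!sumrN.
by congr (_ + _); apply: eq_bigr => i _; rewrite scaleNr.
Qed.

Lemma resid_controls {R : realType} {d1 d2 : nat} (g1 : 'I_d1 -> R)
    (g2 : 'I_d2 -> R) :
  resid iX (vcat iW1 iW2) (vcat g1 g2)
  = cvec 0 1 (fun i => - g1 i) (fun j => - g2 j).
Proof.
rewrite /resid cvec_sum !big_split_ord/=.
under eq_bigr do rewrite !vcatl.
under [X in _ - (_ + X)]eq_bigr do rewrite !vcatr.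
rewrite scale0r add0r scale1r opprD !addrA -!sumrN.
by congr (_ + _ + _); apply: eq_bigr => i _; rewrite scaleNr.
Qed.

(** * Normal equations of the three regressions *)

Section NormalEquations.
Context {d : measure_display} {T : measurableType d} {R : realType}.
Context {d1 d2 : nat} (P : probability T R) (Y X : T -> R)
  (W1 : 'I_d1 -> T -> R) (W2 : 'I_d2 -> T -> R).
Let Z := full4 Y X W1 W2.
Hypothesis Z2 : forall i, Z i \in Lfun P 2%:E.
Let S := varmx P Z.

(** The intercept is existential since covariances constrain the slopes only. One direction serves
    the equality of coefficients, the other produces the long regression of the new vector. *)
Lemma linproj_longP b g1 g2 :
  (exists a, is_linproj P Y (vcat (vcat (vone X) W1) W2) a
               (vcat (vcat (vone b) g1) g2)) <->
  let r := cvec 1 (- b) (fun i => - g1 i) (fun j => - g2 j) in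
  [/\ bil S r (evec iX) = 0, forall i, bil S r (evec (iW1 i)) = 0
    & forall j, bil S r (evec (iW2 j)) = 0].
Proof.
rewrite (full4_long Y) -[Y in is_linproj P Y](full4Y Y X W1 W2) /=.
rewrite -resid_long; split=> [[a /(linproj_orth P Z Z2) H]|[HX H1 H2]].
  split=> [|i|j]; last 1 first.
  - by have := H (rshift _ j); rewrite vcatr.
  - by have := H (lshift _ (lshift _ ord0)); rewrite !vcatl.
  - by have := H (lshift _ (rshift _ i)); rewrite vcatl vcatr.
apply: (orth_linproj P Z Z2) => i.
have [{}i ->|j ->] := split_ordP i; last by rewrite vcatr.
by have [{}i ->|j ->] := split_ordP i; rewrite vcatl ?vcatl ?vcatr.
Qed.

(** The residual is padded with zero coefficients on [W2], so that it can be paired with the other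
    residuals under the same [S]. *)
Lemma linproj_med c b h1 :
  is_linproj P Y (vcat (vone X) W1) c (vcat (vone b) h1) ->
  let r := cvec 1 (- b) (fun i => - h1 i) (fun _ : 'I_d2 => 0) in
  bil S r (evec iX) = 0 /\ forall i, bil S r (evec (iW1 i)) = 0.
Proof.
rewrite (full4_med Y X W1 W2) -[Y in is_linproj P Y](full4Y Y X W1 W2) /=.
rewrite -resid_med => /(linproj_orth P Z Z2) H; split=> [|i].
- by have := H (lshift _ ord0); rewrite !vcatl.
- by have := H (rshift _ i); rewrite vcatr.
Qed.

Lemma linproj_controlsP p1 p2 :
  (exists a, is_linproj P X (vcat W1 W2) a (vcat p1 p2)) <->
  let r := cvec 0 1 (fun i => - p1 i) (fun j => - p2 j) in
  (forall i, bil S r (evec (iW1 i)) = 0) /\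
  (forall j, bil S r (evec (iW2 j)) = 0).
Proof.
rewrite (full4_controls Y X W1 W2) -[X in is_linproj P X](full4X Y X W1 W2) /=.
rewrite -resid_controls; split=> [[a /(linproj_orth P Z Z2) H]|[H1 H2]].
  split=> [i|j]; first by have := H (lshift _ i); rewrite vcatl.
  by have := H (rshift _ j); rewrite vcatr.
apply: (orth_linproj P Z Z2) => i.
by have [{}i ->|j ->] := split_ordP i; rewrite ?vcatl ?vcatr.
Qed.

End NormalEquations.

(** * Replacing one variable by a linear combination *)

Lemma evecE {R : realType} {n : nat} (i j : 'I_n) :
  (evec i : 'rV[R]_n) ord0 j = (j == i)%:R.
Proof. by rewrite mxE eqxx. Qed.

(** The identity with row [p] replaced by [w]: it exchanges variable [p] for the combination [w] and
    keeps the others. *)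
Definition subst_mx {R : realType} {n : nat} (p : 'I_n) (w : 'rV[R]_n) : 'M[R]_n :=
  1%:M + delta_mx p ord0 *m (w - evec p).

Section Substitution.
Context {R : realType} {n : nat}.
Implicit Types (S : 'M[R]_n) (u w : 'rV[R]_n) (p i : 'I_n).

Lemma mul_subst_mx p w u :
  u *m subst_mx p w = u + u ord0 p *: (w - evec p).
Proof.
rewrite /subst_mx mulmxDr mulmx1 mulmxA -colE; congr (_ + _).
by rewrite [col p u]mx11_scalar mul_scalar_mx mxE.
Qed.

Lemma row_subst_mx p w i :
  row i (subst_mx p w) = if i == p then w else evec i.
Proof.
rewrite rowE mul_subst_mx evecE eq_sym; case: eqP => [->|_].
  by rewrite scale1r addrC subrK.
by rewrite scale0r addr0.
Qed.

(** The substitution is injective on row vectors: coordinate [p] of the image of [u] is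
    [u ord0 p * w ord0 p], and once [u ord0 p] vanishes [u] is its own image. *)
Lemma posdef_subst_mx S p w : posdef S -> w ord0 p != 0 ->
  posdef (subst_mx p w *m S *m (subst_mx p w)^T).
Proof.
move=> pS wp u u0; rewrite -/(bil _ u u) bil_congr; apply: pS.
apply: contra_neq u0 => uM; move: (uM); rewrite mul_subst_mx.
have /rowP/(_ p) := uM; rewrite mul_subst_mx !mxE !eqxx mulrBr mulr1 addrC subrK.
by move/eqP; rewrite mulf_eq0 (negbTE wp) orbF => /eqP ->; rewrite scale0r addr0.
Qed.

End Substitution.

Lemma bil_cvec {R : realType} {d1 d2 : nat} (S : 'M[R]_(1 + 1 + d1 + d2)) u a b
    (g1 : 'I_d1 -> R) (g2 : 'I_d2 -> R) :
  bil S u (cvec a b g1 g2) = a * bil S u (evec iY) + b * bil S u (evec iX)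
    + \sum_i g1 i * bil S u (evec (iW1 i)) + \sum_j g2 j * bil S u (evec (iW2 j)).
Proof.
rewrite bil_sumE !big_split_ord/= !big_ord1.
congr (_ + _ + _ + _); rewrite ?cvecY ?cvecX 1?mulrC//; apply: eq_bigr => i _;
  by rewrite ?cvecW1 ?cvecW2 mulrC.
Qed.

Lemma iW2_neq {d1 d2 : nat} (j : 'I_d2) :
  (forall i, iW1 i == iW2 j :> 'I_(1 + 1 + d1 + d2) = false) /\
  (iY == iW2 j :> 'I_(1 + 1 + d1 + d2) = false) /\
  (iX == iW2 j :> 'I_(1 + 1 + d1 + d2) = false).
Proof. by rewrite /iY /iX /iW1 /iW2; split=> [i|]; rewrite !eq_lrshift. Qed.

Lemma iY_neq {d1 d2 : nat} :
  (forall i, iW1 i == iY :> 'I_(1 + 1 + d1 + d2) = false) /\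
  (forall j, iW2 j == iY :> 'I_(1 + 1 + d1 + d2) = false) /\
  (iX == iY :> 'I_(1 + 1 + d1 + d2) = false).
Proof.
rewrite /iY /iX /iW1 /iW2; split; [|split] => [i|j|].
- by rewrite eq_lshift eq_rlshift.
- by rewrite eq_rlshift.
- by rewrite !eq_lshift.
Qed.

Lemma iW2_eq {d1 d2 : nat} (j k : 'I_d2) :
  (iW2 j == iW2 k :> 'I_(1 + 1 + d1 + d2)) = (j == k).
Proof. by rewrite /iW2 eq_rshift. Qed.

(** * Algebraic core: equality of the two coefficients, and the replacement *)

Section LongMedium.
Context {R : realType} {d1 d2 : nat} (S : 'M[R]_(1 + 1 + d1 + d2)).
Hypotheses (pS : posdef S) (symS : S^T = S).

(** Partialling out: pairing [rx] with the two residuals gives [<rx, Y> = bl <rx, X>] and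
    [<rx, Y> = bm <rx, X>], where [<rx, X> = <rx, rx> > 0]. The entries [- 0] are the form taken by
    [pi2 = 0] in [linproj_controlsP]. *)
Lemma beta_long_med (bl bm : R) (g1 h1 p1 : 'I_d1 -> R) (g2 : 'I_d2 -> R) :
  let rl := cvec 1 (- bl) (fun i => - g1 i) (fun j => - g2 j) in
  let rm := cvec 1 (- bm) (fun i => - h1 i) (fun _ : 'I_d2 => 0) in
  let rx := cvec 0 1 (fun i => - p1 i) (fun _ : 'I_d2 => - 0) in
  [/\ bil S rl (evec iX) = 0, forall i, bil S rl (evec (iW1 i)) = 0
    & forall j, bil S rl (evec (iW2 j)) = 0] ->
  bil S rm (evec iX) = 0 /\ (forall i, bil S rm (evec (iW1 i)) = 0) ->
  (forall i, bil S rx (evec (iW1 i)) = 0) /\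
  (forall j, bil S rx (evec (iW2 j)) = 0) ->
  bl = bm.
Proof.
move=> rl rm rx [lX l1 l2] [mX m1] [x1 x2].
have l0 : bil S rx rl = 0.
  rewrite bilC// bil_cvec mul0r lX !big1 ?mulr0 ?addr0// => i _.
    by rewrite l2 mulr0.
  by rewrite l1 mulr0.
(* Here [pi2 = 0] enters: [rx] involves only [X] and [W1], to which the medium residual is
   orthogonal. *)
have m0 : bil S rx rm = 0.
  rewrite bilC// bil_cvec mul0r mX !big1 ?mulr0 ?addr0// => i _.
    by rewrite oppr0 mul0r.
  by rewrite m1 mulr0.
have xx : bil S rx rx = bil S rx (evec iX).
  rewrite bil_cvec mul0r add0r mul1r !big1 ?addr0// => i _.
    by rewrite x2 mulr0.
  by rewrite x1 mulr0.
have x0 : 0 < bil S rx (evec iX).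
  rewrite -xx; apply: pS; apply/eqP => /rowP/(_ iX).
  by rewrite cvecX mxE => /eqP; rewrite oner_eq0.
have sum0 (k : nat) (g : 'I_k -> R) (f : 'I_k -> 'I_(1 + 1 + d1 + d2)) :
    (forall i, bil S rx (evec (f i)) = 0) ->
    \sum_i g i * bil S rx (evec (f i)) = 0.
  by move=> f0; rewrite big1// => i _; rewrite f0 mulr0.
move: l0 m0; rewrite !bil_cvec !sum0// !addr0 => l0 m0.
apply/eqP; rewrite -subr_eq0 -(mulIr_eq0 _ (mulIf (lt0r_neq0 x0))).
by apply/eqP; lra.
Qed.

(* With [e] the residual of [Y] on every regressor but [W2 j0], and [v] the
   residual of [W2 j0] on all the other variables, [W2 j0] is replaced by
   [w = (h1 - g1).W1 + e/2 + k v], where [h1] is the coefficient of [W1] in the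
   first projection. The new long residual is [e/2 - k v], and [k] is fixed by
   the requirement that it be orthogonal to [w]. *)
Lemma exists_replacement (g1 : 'I_d1 -> R) (j0 : 'I_d2) :
  let p := iW2 j0 in
  exists (w : 'rV[R]_(1 + 1 + d1 + d2)) (b : R) (g2 : 'I_d2 -> R),
  [/\ w ord0 p != 0,
      forall p1, let rx := cvec 0 1 (fun i => - p1 i) (fun _ : 'I_d2 => - 0) in
        (forall i, bil S rx (evec (iW1 i)) = 0) ->
        (forall j, bil S rx (evec (iW2 j)) = 0) -> bil S rx w = 0,
      forall i, i != iY -> i != p ->
        bil S (cvec 1 (- b) (fun i => - g1 i) (fun j => - g2 j) *m subst_mx p w)
          (evec i) = 0
    & bil S (cvec 1 (- b) (fun i => - g1 i) (fun j => - g2 j) *m subst_mx p w) w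
        = 0].
Proof.
move=> p.
have [n1 [nY nX]] := @iW2_neq d1 d2 j0; rewrite -/p in n1 nY nX.
have [y1 [y2 yX]] := @iY_neq d1 d2.
have [u [u0 uO]] := coord_projection S (fun i => (i != iY) && (i != p))
  (evec iY) pS symS.
have [t [t0 tO]] := coord_projection S (fun i => i != p) (evec p) pS symS.
set e := _ - u in uO; set v := _ - t in tO.
have uY : u ord0 iY = 0 by rewrite u0 ?eqxx.
have up : u ord0 p = 0 by rewrite u0 ?eqxx ?andbF.
have tp : t ord0 p = 0 by rewrite t0 ?eqxx.
have eE i : e ord0 i = (i == iY)%:R - u ord0 i by rewrite mxE evecE mxE.
have vp : v ord0 p = 1 by rewrite mxE evecE mxE eqxx tp subr0.
have ep : e ord0 p = 0 by rewrite eE eq_sym nY up subr0.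
have qe : 0 < bil S e e.
  apply: pS; apply/eqP => /rowP/(_ iY).
  by rewrite eE eqxx uY subr0 mxE => /eqP; rewrite oner_eq0.
have qv : 0 < bil S v v.
  by apply: pS; apply/eqP => /rowP/(_ p); rewrite vp mxE => /eqP; rewrite oner_eq0.
(* [e] has no component at [p], and [v] is orthogonal to every other coordinate vector. *)
have ve : bil S v e = 0.
  by apply: bil_eq0 => i; have [->|ip] := eqVneq i p; [left|right; exact: tO].
have ev : bil S e v = 0 by rewrite bilC.
(* With all cross terms zero, orthogonality of [e/2 - k v] to [D + e/2 + k v] reads
   [<e, e> / 4 = k^2 <v, v>]. A positive root also makes the entry of [w] at [p], which is [k],
   nonzero. *)
pose k := Num.sqrt (bil S e e / (4 * bil S v v)).
have k0 : 0 < k by rewrite sqrtr_gt0 divr_gt0// mulr_gt0.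
have k2 : k ^+ 2 * bil S v v = bil S e e / 4.
  rewrite sqr_sqrtr; last by rewrite ltW// divr_gt0// mulr_gt0.
  by field; rewrite gt_eqF.
pose D : 'rV[R]_(1 + 1 + d1 + d2) :=
  cvec 0 0 (fun i => u ord0 (iW1 i) - g1 i) (fun=> 0).
have DO x : (forall i, bil S x (evec (iW1 i)) = 0) -> bil S x D = 0.
  move=> x1; rewrite bil_cvec !mul0r !add0r !big1 ?addr0// => i _.
    by rewrite mul0r.
  by rewrite x1 mulr0.
have eD : bil S e D = 0 by apply: DO => i; apply: uO; rewrite y1 n1.
have vD : bil S v D = 0 by apply: DO => i; apply: tO; rewrite n1.
pose w := D + 2^-1 *: e + k *: v.
(* Slope 1 on the replaced variable makes the new residual [e + D - w]; its [D] shifts the slopes on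
   [W1] from those of [u] to [g1] and cancels against the [D] in [w]. *)
pose g2 j := u ord0 (iW2 j) + (j == j0)%:R.
pose r := cvec 1 (- u ord0 iX) (fun i => - g1 i) (fun j => - g2 j).
have rE : r = e + D - evec p.
  apply/rowP; apply: block_ind => [||i|j]; rewrite cvecE [RHS]mxE [X in _ = X + _]mxE
    eE cvecE [X in _ = _ + X]mxE evecE ?eqxx ?nY ?nX ?n1 ?yX ?y1 ?y2 ?uY /=.
  - by ring.
  - by ring.
  - by ring.
  - by rewrite iW2_eq /g2; ring.
have rp : r ord0 p = -1 by rewrite cvecW2 /g2 up eqxx add0r.
have rM : r *m subst_mx p w = 2^-1 *: e - k *: v.
  have alg (x1 x2 x3 x4 : 'rV[R]_(1 + 1 + d1 + d2)) c :
      x1 + x2 - x3 - (x2 + 2^-1 *: x1 + c *: x4 - x3) = 2^-1 *: x1 - c *: x4.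
    by apply/rowP => i; rewrite !mxE; field.
  by rewrite mul_subst_mx rp rE scaleN1r alg.
exists w, (u ord0 iX), g2; split.
- rewrite mxE [X in X + _]mxE cvecW2 [X in _ + X + _]mxE [X in _ + X]mxE vp ep.
  by rewrite mulr0 !add0r mulr1 gt_eqF.
(* [rx] is orthogonal to [D], a combination of [W1]; [e] and [v] are orthogonal to [X] and [W1], of
   which [rx] is a combination. *)
- move=> p1 rx x1 x2; rewrite !bilDr !bilZr DO// (bilC S rx e)// (bilC S rx v)//.
  rewrite !bil_cvec !mul0r tO ?nX// uO ?yX ?nX//.
  rewrite !big1 ?(mulr0, addr0)// => i _; first by rewrite oppr0 mul0r.
  + by rewrite tO ?n1 ?mulr0.
  + by rewrite oppr0 mul0r.
  + by rewrite uO ?y1 ?n1 ?mulr0.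
- move=> i iY ip; rewrite rM bilDl bilNl !bilZl uO ?iY ?ip// tO//.
  by rewrite !mulr0 subr0.
- rewrite rM /w !bilDl !bilDr !bilNl !bilZl !bilZr eD vD ev ve.
  have -> : bil S e e = 4 * (k ^+ 2 * bil S v v) by rewrite k2; field.
  by field.
Qed.

End LongMedium.

(** * Transfer of both claims to the random vectors *)

Theorem mainTheorem5 (R : realType) (d : measure_display) (T : measurableType d)
  (P : probability T R) (d1 d2 : nat) (Y X : T -> R)
  (W1 : 'I_d1 -> T -> R) (W2 : 'I_d2 -> T -> R) :
  (0 < d2)%N ->
  finite_2nd_moments P (full4 Y X W1 W2) ->
  A1_pi2 P Y X W1 W2 ->
  (* (i) beta_long = beta_med *)
  (forall (a : R) (bl : R) (g1 : 'I_d1 -> R) (g2 : 'I_d2 -> R)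
          (c : R) (bm : R) (h1 : 'I_d1 -> R),
     is_linproj P Y (vcat (vcat (vone X) W1) W2) a (vcat (vcat (vone bl) g1) g2) ->
     is_linproj P Y (vcat (vone X) W1) c (vcat (vone bm) h1) ->
     bl = bm) /\
  (* (ii) the identified set for gamma_1 is all of R^d1 *)
  (forall g1 : 'I_d1 -> R,
     exists (d' : measure_display) (T' : measurableType d')
            (P' : probability T' R) (Y' X' : T' -> R)
            (W1' : 'I_d1 -> T' -> R) (W2' : 'I_d2 -> T' -> R),
       finite_2nd_moments P' (full4 Y' X' W1' W2') /\
       law_eq P (first3 Y X W1) P' (first3 Y' X' W1') /\
       A1_pi2 P' Y' X' W1' W2' /\
       exists (a : R) (bl : R) (g2 : 'I_d2 -> R),
         is_linproj P' Y' (vcat (vcat (vone X') W1') W2') a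
           (vcat (vcat (vone bl) g1) g2)).
Proof.
move=> d2_gt0 fin2 [pS [pi0 [pi1 projX]]].
set Z := full4 Y X W1 W2 in fin2 pS.
have Z2 i : Z i \in Lfun P 2%:E by exact/Lfun2P/fin2.
have symS : (varmx P Z)^T = varmx P Z := varmx_sym P Z.
have orthX := (linproj_controlsP P Y X W1 W2 Z2 pi1 (fun=> 0)).1
  (ex_intro (fun a => is_linproj P X (vcat W1 W2) a _) pi0 projX).
split=> [a bl g1 g2 c bm h1 long med|g1].
  apply: (beta_long_med _ pS symS bl bm g1 h1 pi1 g2) orthX.
    by apply/(linproj_longP P Y X W1 W2 Z2); exists a.
  exact: (linproj_med P Y X W1 W2 Z2 c bm h1 med).
(* The condition [d2 >= 1] provides the component of [W2] to be replaced. *)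
pose j0 := Ordinal d2_gt0.
have [w [b [g2 [wp xw longO longw]]]] := exists_replacement _ pS symS g1 j0.
pose M := subst_mx (iW2 j0) w.
pose W2' j := if j == j0 then lincomb Z w else W2 j.
have rowM i : full4 Y X W1 W2' i = lincomb Z (row i M).
  have [n1 [nY nX]] := @iW2_neq d1 d2 j0.
  rewrite row_subst_mx; move: i.
  apply: block_ind => [||i|j]; rewrite full4E ?nY ?nX ?n1
    ?lincomb_evec /Z ?full4E//.
  by rewrite iW2_eq /W2'; case: eqP => // _; rewrite lincomb_evec full4E.
have Z'E : full4 Y X W1 W2' = fun i => lincomb Z (row i M) by apply/funext.
have S'E : varmx P (full4 Y X W1 W2') = M *m varmx P Z *m M^T.
  by rewrite Z'E varmx_lincomb.
have Z'2 i : full4 Y X W1 W2' i \in Lfun P 2%:E by rewrite rowM lincomb_Lfun.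
have evecM i : evec i *m M = if i == iW2 j0 then w else evec i.
  by rewrite -rowE row_subst_mx.
exists d, T, P, Y, X, W1, W2'; split; [|split; [|split]].
- by move=> i; apply/Lfun2P.
- by move=> B _.
- split; first by rewrite S'E; exact: posdef_subst_mx.
  have [x1 x2] := orthX.
  suff [p0 Hp0] : exists a, is_linproj P X (vcat W1 W2') a (vcat pi1 (fun=> 0)).
    by exists p0, pi1.
  apply/(linproj_controlsP P Y X W1 W2' Z'2) => /=; rewrite S'E.
  (* [rx] puts no weight on the replaced variable, so the substitution fixes it and the old [pi1]
     still works. *)
  have rxM : cvec 0 1 (fun i => - pi1 i) (fun _ : 'I_d2 => - 0) *m M
      = cvec 0 1 (fun i => - pi1 i) (fun _ : 'I_d2 => - 0 : R).
    by rewrite mul_subst_mx cvecW2 oppr0 scale0r addr0.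
  have [n1 _] := @iW2_neq d1 d2 j0.
  split=> [i|j]; rewrite bil_congr rxM evecM; first by rewrite n1.
  by case: ifP => // _; exact: xw.
- suff [a Ha] : exists a, is_linproj P Y (vcat (vcat (vone X) W1) W2') a
      (vcat (vcat (vone b) g1) g2) by exists a, b, g2.
  apply/(linproj_longP P Y X W1 W2' Z'2) => /=; rewrite S'E.
  (* In the old coordinates the replaced variable is [w], covered by [longw]; [longO] covers every
     other regressor. *)
  have O' i : i != iY -> bil (M *m varmx P Z *m M^T)
      (cvec 1 (- b) (fun i => - g1 i) (fun j => - g2 j)) (evec i) = 0.
    by move=> iY; rewrite bil_congr evecM; case: eqP => // /eqP ip; exact: longO.
  have [y1 [y2 yX]] := @iY_neq d1 d2.
  by split=> [|i|j]; apply: O'; rewrite ?yX ?y1 ?y2.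
Qed.
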